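(* Let $g=\{g_1,\dots,g_m\}$ and $h=\{h_1,\dots,h_l\}$ be finite sets of polynomials in $\mathbb{R}[x]$ with $S(g,h)\ne\emptyset$. Let $(a_t)_{t=0,\dots,n}\subset\mathbb{R}^n$ be such that $a_t-a_0$, $t=1,\dots,n$, are linearly independent in $\mathbb{R}^n$. Define the sequence $(\xi_t)_{t=0,1,\dots,n}\subset\mathbb{R}_+$ by $$\xi_0:=\min\{\|x-a_0\|_2^2:\ x\in S(g,h)\},$$ $$\xi_t:=\min\{\|x-a_t\|_2^2:\ x\in S(g,\,h\cup\{\xi_j-\|x-a_j\|_2^2:\ j=0,\dots,t-1\})\},\quad t=1,\dots,n.$$ Then there exists a unique real point $x^\star$ in $S(g,\,h\cup\{\xi_t-\|x-a_t\|_2^2:\ t=0,\dots,n\})$, and it satisfies the non-singular linear system of equations $$(a_t-a_0)^Tx^\star=-\tfrac12\left(\xi_t-\xi_0-\|a_t\|_2^2+\|a_0\|_2^2\right),\quad t=1,\dots,n.$$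
   Context: $x=(x_1,\dots,x_n)$. For finite sets $g,h\subset\mathbb{R}[x]$, $S(g,h):=\{x\in\mathbb{R}^n:\ p(x)\ge0\ \text{for all }p\in g,\ q(x)=0\ \text{for all }q\in h\}$. *)

(* Defs.v *)
From mathcomp Require Import all_boot all_order all_algebra.
From mathcomp Require Import mpoly.
From mathcomp Require Import boolp classical_sets reals.

Set Implicit Arguments.
Unset Strict Implicit.
Unset Printing Implicit Defensive.

Import Order.TTheory GRing.Theory Num.Theory.

Local Open Scope classical_set_scope.
Local Open Scope ring_scope.

Section Defs.
Variables (R : realType) (n : nat).

(* The Euclidean norm; the norm that MathComp-Analysis puts on matrices is the
   sup norm. *)
Definition norm2 (x : 'cV[R]_n) : R := Num.sqrt (\sum_i x i 0 ^+ 2).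

Definition evalp (p : {mpoly R[n]}) (x : 'cV[R]_n) : R := p.@[fun i => x i 0].

(* S(g,h); the finite sets g and h are given by lists of their elements. *)
Definition semialg (g h : seq {mpoly R[n]}) : set 'cV[R]_n :=
  [set x | (forall p, p \in g -> 0 <= evalp p x) /\
           (forall q, q \in h -> evalp q x = 0)].

Definition is_min (A : set R) (m : R) : Prop := A m /\ lbound A m.

(* The polynomial r - |x - a|_2^2 in the variable x. *)
Definition sphere_poly (a : 'cV[R]_n) (r : R) : {mpoly R[n]} :=
  r%:MP - \sum_i ('X_i - (a i 0)%:MP) ^+ 2.

Lemma evalp_sphere a r x : evalp (sphere_poly a r) x = r - norm2 (x - a) ^+ 2.
Proof.
rewrite /norm2 sqr_sqrtr; last by apply: sumr_ge0 => i _; exact: sqr_ge0.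
rewrite /evalp /sphere_poly mevalB mevalC (raddf_sum (meval _)).
congr (_ - _); apply: eq_bigr => i _.
by rewrite /= !expr2 mevalM mevalB mevalXU mevalC !mxE.
Qed.

(* The polynomials xi_j - |x - a_j|_2^2 for j < k. *)
Definition spheres (a : 'I_n.+1 -> 'cV[R]_n) (xi : 'I_n.+1 -> R) (k : nat) :
    seq {mpoly R[n]} :=
  [seq sphere_poly (a j) (xi j) | j : 'I_n.+1 <- enum 'I_n.+1 & (j < k)%N].

(* xi_t only depends on the xi_j with j < t, so this recursive specification
   determines xi; the minimum is required to be attained. *)
Definition is_xi_seq (g h : seq {mpoly R[n]}) (a : 'I_n.+1 -> 'cV[R]_n)
    (xi : 'I_n.+1 -> R) : Prop :=
  forall t : 'I_n.+1,
    is_min [set norm2 (x - a t) ^+ 2 | x in semialg g (h ++ spheres a xi t)]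
           (xi t).

End Defs.

(* Main.v *)
Require Import Defs.
From mathcomp Require Import all_boot all_order all_algebra.
From mathcomp Require mpoly.
From mathcomp Require Import boolp classical_sets reals.
From mathcomp Require Import topology normedtype derive realfun ring.

Import Order.TTheory GRing.Theory Num.Theory.
Import -(notations) mpoly.
Import numFieldNormedType.Exports.

Local Open Scope classical_set_scope.
Local Open Scope ring_scope.

(** The existence half is Weierstrass' theorem. A basic semialgebraic set is
    closed because polynomials are continuous; to minimise the distance to [a]
    over it one may discard the points farther from [a] than some chosen point of
    the set, and what remains is closed and bounded, hence compact
    ([dist_min_exists]). The minimisers of step [t] form exactly the feasible set
    of step [t + 1], so no feasible set is empty and the recursion can always
    be continued ([xi_seq_exists]); reaching the last step is also what gives a point
    lying on all the spheres at once ([xi_seq_feasible]).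

    The uniqueness half is trilateration. Subtracting the equation of the sphere
    around [a ord0] from the one around [a (lift ord0 t)] cancels the quadratic
    term, so that every point on all the spheres solves one linear system
    ([spheres_linear]). Its rows are the vectors [a (lift ord0 t) - a ord0],
    which are independent ([free_unitmx]), so it has only one solution. *)

(** * Semialgebraic sets are closed and contain nearest points *)

Section NearestPoint.
Context {R : realType} {n : nat}.
Implicit Types (g h : seq (mpoly.mpoly n R)) (a x : 'cV[R]_n).

Lemma evalp_continuous (p : mpoly.mpoly n R) :
  continuous (fun v : 'rV[R]_n => evalp p v^T).
Proof.
rewrite /evalp; under eq_fun => v do rewrite mpoly.mevalE.
apply: (continuous_big add_continuous) => m _ v.
apply: continuousM; first exact: cst_continuous.
apply: (continuous_big mul_continuous) => i _ w.
under eq_fun => u do rewrite mxE.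
have := @continuous_comp _ _ _ (fun u : 'rV[R]_n => u 0 i)
  (fun r : R => r ^+ mpoly.fun_of_multinom m i) w.
by apply; [exact: coord_continuous | exact: exprn_continuous].
Qed.

Lemma semialg_closed g h : closed [set v : 'rV[R]_n | semialg g h v^T].
Proof.
have preim p (D : set R) :
    closed D -> closed [set v : 'rV[R]_n | D (evalp p v^T)].
  by move=> Dc; have /continuous_closedP := evalp_continuous p; apply.
rewrite (_ : [set _ | _] =
  (\bigcap_(p in [set` g]) [set v : 'rV[R]_n | 0 <= evalp p v^T]) `&`
  (\bigcap_(q in [set` h]) [set v : 'rV[R]_n | evalp q v^T = 0])).
  apply: closedI; apply: closed_bigI => p _.
    by apply: (preim p [set r | 0 <= r]); exact: closed_ge.
  by apply: (preim p [set r | r = 0]); exact: closed_eq.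
by apply/seteqP; split => v [].
Qed.

Lemma norm2_sqE x : norm2 x ^+ 2 = \sum_i x i 0 ^+ 2.
Proof. by rewrite sqr_sqrtr// sumr_ge0// => i _; exact: sqr_ge0. Qed.

Lemma norm2_coord_le x i : `|x i 0| <= norm2 x.
Proof.
rewrite -sqrtr_sqr ler_wsqrtr// (bigD1 i)//= lerDl.
by rewrite sumr_ge0// => j _; exact: sqr_ge0.
Qed.

(** Bounded because the constraint [sphere_poly a r] confines the set to a
    Euclidean ball, hence to a box. *)
Lemma semialg_ball_compact g h a (r : R) :
  compact [set v : 'rV[R]_n | semialg (sphere_poly a r :: g) h v^T].
Proof.
apply: bounded_closed_compact; last exact: semialg_closed.
suff inball (v : 'rV[R]_n) : semialg (sphere_poly a r :: g) h v^T ->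
    `|v| <= Num.sqrt r + `|a|.
  exists (Num.sqrt r + `|a|); split; first exact: num_real.
  by move=> M /ltW ltM v /inball/le_trans; apply.
move=> [/(_ (sphere_poly a r))]; rewrite mem_head => /(_ isT) + _.
rewrite evalp_sphere subr_ge0 => vr.
have {}vr : norm2 (v^T - a) <= Num.sqrt r.
  by rewrite -(@ger0_norm _ (norm2 _)) ?sqrtr_ge0// -sqrtr_sqr ler_wsqrtr.
rewrite [`|v|]mx_normrE; apply/bigmax_leP; split=> [|[j i] _ /=].
  by rewrite addr_ge0// sqrtr_ge0.
have -> : v j i = (v^T - a) i 0 + a i 0 by rewrite !mxE subrK (ord1 j).
rewrite (le_trans (ler_normD _ _))// lerD//.
  exact: le_trans (norm2_coord_le _ _) vr.
by rewrite [`|a|]mx_normrE; apply/bigmax_geP; right; exists (i, 0).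
Qed.

(** The set need not be bounded, but points farther from [a] than a known
    feasible point [x0] cannot be nearest, which leaves a compact set. *)
Lemma dist_min_exists g h a : semialg g h !=set0 ->
  exists r, is_min [set norm2 (x - a) ^+ 2 | x in semialg g h] r.
Proof.
move=> [x0 x0S]; set r := norm2 (x0 - a) ^+ 2.
have inK x : semialg (sphere_poly a r :: g) h x <->
    semialg g h x /\ norm2 (x - a) ^+ 2 <= r.
  rewrite -subr_ge0 -evalp_sphere; split=> [[gx hx]|[[gx hx] sx]].
    split; last by apply: gx; rewrite mem_head.
    by split=> // p pg; apply: gx; rewrite inE pg orbT.
  by split=> // p; rewrite inE => /predU1P[->//|/gx].
pose f (v : 'rV[R]_n) : R := norm2 (v^T - a) ^+ 2.
have fc : continuous f.
  (* the squared distance is minus the sphere polynomial of radius 0 *)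
  have -> : f = fun v => - evalp (sphere_poly a 0) v^T.
    by apply/funext => v; rewrite evalp_sphere sub0r opprK.
  by move=> v; exact: cvgN (evalp_continuous (sphere_poly a 0) v).
have [||v] := @EVT_min_rV R n f _ _ (semialg_ball_compact g h a r).
- by exists x0^T; rewrite /= trmxK inK.
- exact: continuous_subspaceT.
rewrite inE /= inK => -[vS vr] vmin.
exists (f v); split; first by exists v^T.
move=> _ [x xS <-].
have [xr|/ltW rx] := leP (norm2 (x - a) ^+ 2) r; last exact: le_trans vr rx.
have := vmin x^T; rewrite /f trmxK; apply.
by rewrite inE /= trmxK inK.
Qed.

(** * The recursive sequence of minima *)

Lemma semialg_spheresE g h (a : 'I_n.+1 -> 'cV[R]_n) (xi : 'I_n.+1 -> R) k x :
  semialg g (h ++ spheres a xi k) x <->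
  semialg g h x /\ forall j : 'I_n.+1, (j < k)%N -> norm2 (x - a j) ^+ 2 = xi j.
Proof.
split=> [[gx hx]|[[gx hx] sx]].
  split; first by split=> // q qh; apply: hx; rewrite mem_cat qh.
  move=> j jk; apply/esym/eqP; rewrite -subr_eq0 -evalp_sphere; apply/eqP.
  apply: hx; rewrite mem_cat; apply/orP; right.
  by apply/mapP; exists j => //; rewrite mem_filter jk mem_enum.
split=> // q; rewrite mem_cat => /orP[/hx//|/mapP[j]].
by rewrite mem_filter => /andP[jk _] ->; rewrite evalp_sphere sx// subrr.
Qed.

(** Lets an initial segment of the sequence be kept when its next value is
    chosen. *)
Lemma semialg_spheres_ext g h (a : 'I_n.+1 -> 'cV[R]_n)
    (xi xi' : 'I_n.+1 -> R) k :
  (forall j : 'I_n.+1, (j < k)%N -> xi j = xi' j) ->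
  semialg g (h ++ spheres a xi k) = semialg g (h ++ spheres a xi' k).
Proof.
move=> E; apply/seteqP; split=> x /semialg_spheresE[xS sx];
  by apply/semialg_spheresE; split=> // j jk; rewrite sx// E.
Qed.

(** A point attaining the minimum of step [t] lies on the sphere of index [t]
    too, hence is feasible for step [t + 1]. *)
Lemma semialg_spheresS g h (a : 'I_n.+1 -> 'cV[R]_n) (xi : 'I_n.+1 -> R)
    (t : 'I_n.+1) x :
  semialg g (h ++ spheres a xi t) x -> norm2 (x - a t) ^+ 2 = xi t ->
  semialg g (h ++ spheres a xi t.+1) x.
Proof.
move=> /semialg_spheresE[xS sx] xt; apply/semialg_spheresE; split=> // j.
by rewrite ltnS leq_eqVlt => /predU1P[/val_inj->//|]; exact: sx.
Qed.

Lemma xi_seq_exists g h (a : 'I_n.+1 -> 'cV[R]_n) : semialg g h !=set0 ->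
  exists xi, is_xi_seq g h a xi.
Proof.
move=> S0.
(* A partial sequence can be continued only if its feasible set is nonempty,
   so this is carried along. *)
suff partial k : (k <= n.+1)%N -> exists xi : 'I_n.+1 -> R,
    (forall t : 'I_n.+1, (t < k)%N ->
      is_min [set norm2 (x - a t) ^+ 2 | x in semialg g (h ++ spheres a xi t)]
        (xi t)) /\
    semialg g (h ++ spheres a xi k) !=set0.
  have [xi [xiP _]] := partial n.+1 (leqnn _).
  by exists xi => t; exact: xiP.
elim: k => [_|k IH kn].
  exists (fun=> 0); split=> //.
  by have [x xS] := S0; exists x; apply/semialg_spheresE.
have [xi [xiP feas]] := IH (ltnW kn).
pose t0 := Ordinal kn.
have [r rmin] := dist_min_exists g (h ++ spheres a xi k) (a t0) feas.
pose xi' j := if j == t0 then r else xi j.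
have xi'E (t : 'I_n.+1) : (t <= k)%N ->
    semialg g (h ++ spheres a xi' t) = semialg g (h ++ spheres a xi t).
  move=> tk; apply: semialg_spheres_ext => j jt; rewrite /xi'.
  by case: eqP => // jt0; move: (leq_trans jt tk); rewrite jt0 ltnn.
have [x xS xr] := rmin.1.
exists xi'; split; last first.
  exists x; apply: (semialg_spheresS g h a xi' t0); first by rewrite xi'E.
  by rewrite /xi' eqxx.
move=> t; rewrite ltnS => tk; rewrite xi'E// /xi'.
have [-> //|tt0] := eqVneq t t0.
by apply: xiP; rewrite ltn_neqAle tk andbT.
Qed.

Lemma xi_seq_feasible g h (a : 'I_n.+1 -> 'cV[R]_n) xi :
  is_xi_seq g h a xi -> semialg g (h ++ spheres a xi n.+1) !=set0.
Proof.
move=> /(_ ord_max)[[x xS xt] _]; exists x.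
exact: (semialg_spheresS g h a xi ord_max).
Qed.

End NearestPoint.

(** * Trilateration *)

Section Trilateration.
Context {R : realType} {n : nat}.
Implicit Types a x : 'cV[R]_n.

Lemma norm2_subE x a :
  norm2 (x - a) ^+ 2 = norm2 x ^+ 2 - 2 * (a^T *m x) 0 0 + norm2 a ^+ 2.
Proof.
rewrite !norm2_sqE [(_ *m _) 0 0]mxE mulr_sumr -sumrB -big_split /=.
by apply: eq_bigr => i _; rewrite !mxE; ring.
Qed.

Lemma spheres_linear x a b (r s : R) :
  norm2 (x - a) ^+ 2 = r -> norm2 (x - b) ^+ 2 = s ->
  ((b - a)^T *m x) 0 0 =
  - 2^-1 * (s - r - norm2 b ^+ 2 + norm2 a ^+ 2).
Proof.
move=> <- <-; rewrite !norm2_subE linearB /= mulmxBl !mxE.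
by field.
Qed.

(** A row vector killing the matrix is, after transposition, the list of
    coefficients of a vanishing combination of the [v t]. *)
Lemma free_unitmx (v : 'I_n -> 'cV[R]_n) :
  free [seq v t | t <- enum 'I_n] -> \matrix_(t < n) (v t)^T \in unitmx.
Proof.
have vs : size [seq v t | t <- enum 'I_n] == n by rewrite size_map size_enum_ord.
move=> /(@freeP _ _ _ (Tuple vs)) vfree.
rewrite -row_free_unit; apply: inj_row_free => u uM0.
apply/rowP => i; rewrite mxE; apply: vfree i.
transitivity (u *m \matrix_(t < n) (v t)^T)^T; last by rewrite uM0 trmx0.
rewrite mulmx_sum_row linear_sum; apply: eq_bigr => i _.
by rewrite linearZ /= rowK trmxK (nth_map i) ?size_enum_ord// nth_ord_enum.
Qed.

End Trilateration.

Theorem lemma4p1 (R : realType) (n : nat) (g h : seq (mpoly.mpoly n R))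
    (S_neq0 : semialg g h !=set0)
    (a : 'I_n.+1 -> 'cV[R]_n)
    (a_free : free [seq a (lift ord0 t) - a ord0 | t <- enum 'I_n]) :
  (exists xi : 'I_n.+1 -> R, is_xi_seq g h a xi) /\
  (forall xi : 'I_n.+1 -> R, is_xi_seq g h a xi ->
     (forall t, 0 <= xi t) /\
     exists xstar : 'cV[R]_n,
       [/\ semialg g (h ++ spheres a xi n.+1) xstar,
           forall y, semialg g (h ++ spheres a xi n.+1) y -> y = xstar,
           \matrix_(t < n) (a (lift ord0 t) - a ord0)^T \in unitmx &
           forall t : 'I_n,
             ((a (lift ord0 t) - a ord0)^T *m xstar) 0 0 =
             - 2^-1 * (xi (lift ord0 t) - xi ord0
                       - norm2 (a (lift ord0 t)) ^+ 2 + norm2 (a ord0) ^+ 2)]).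
Proof.
split; first exact: xi_seq_exists.
move=> xi xiP; split=> [t|].
  by have [[x _ <-] _] := xiP t; exact: sqr_ge0.
have lin_sys (x : 'cV[R]_n) : semialg g (h ++ spheres a xi n.+1) x ->
    forall t : 'I_n, ((a (lift ord0 t) - a ord0)^T *m x) 0 0 =
      - 2^-1 * (xi (lift ord0 t) - xi ord0
                - norm2 (a (lift ord0 t)) ^+ 2 + norm2 (a ord0) ^+ 2).
  by move=> /semialg_spheresE[_ sx] t; apply: spheres_linear; exact: sx.
have Munit := free_unitmx _ a_free.
have [x xS] := xi_seq_feasible g h a xi xiP.
exists x; split=> //; last exact: lin_sys.
move=> y yS; apply: (can_inj (mulKmx Munit)).
apply/matrixP => t j; rewrite (ord1 j).
have rowE z : ((\matrix_t (a (lift ord0 t) - a ord0)^T) *m z) t 0 =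
    ((a (lift ord0 t) - a ord0)^T *m z) 0 0 :> R.
  by rewrite !mxE; apply: eq_bigr => k _; rewrite !mxE.
by rewrite !rowE !lin_sys.
Qed.
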